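(* Let $p,d$ be integers with $2\le p\le d$, and let $\tilde k_{ORF}(x,y)$ be the orthogonal-random-features approximate kernel built from $p$ random vectors $w_1,\dots,w_p\in\mathbb{R}^d$. Then for all $x,y\in\mathbb{R}^d$, with $z:=\|x-y\|$, $$\mathbb{E}[\tilde k_{ORF}(x,y)] = j_{d/2-1}(z),$$ where $j_{d/2-1}$ is the normalized Bessel function of the first kind $$j_{d/2-1}(z)=\sum_{n\ge 0}\frac{(-1)^n\,\Gamma(d/2)}{n!\,\Gamma(n+d/2)}\left(\frac z2\right)^{2n}.$$
   Context: Let $O$ be a random $d\times d$ orthogonal matrix distributed according to the Haar probability measure on the orthogonal group $O(d)$, and let $w_1,\dots,w_p\in\mathbb{R}^d$ be $p$ distinct columns of $O$ (say the first $p$). For $x\in\mathbb{R}^d$ put $$\tilde\phi_{ORF}(x):=\frac1{\sqrt p}\big(\sin(w_1^\top x),\dots,\sin(w_p^\top x),\cos(w_1^\top x),\dots,\cos(w_p^\top x)\big)^\top\in\mathbb{R}^{2p}.$$ The ORF approximate kernel is $$\tilde k_{ORF}(x,y):=\tilde\phi_{ORF}(x)^\top\tilde\phi_{ORF}(y)=\frac1p\sum_{j=1}^p\cos(w_j^\top(x-y)).$$ $\|\cdot\|$ is the Euclidean norm, $\Gamma$ is the Gamma function, and expectation is over the randomness of $O$. *)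

(* Defs.v *)
From HB Require Import structures.
From mathcomp Require Import all_boot all_order all_algebra.
From mathcomp Require Import all_classical all_reals all_analysis.

Set Implicit Arguments.
Unset Strict Implicit.
Unset Printing Implicit Defensive.

Import Order.TTheory GRing.Theory Num.Theory.
Import numFieldNormedType.Exports.

Local Open Scope classical_set_scope.
Local Open Scope ring_scope.

(* The library's norm on matrices is the sup norm. *)
Definition enorm (R : realType) (d : nat) (x : 'cV[R]_d) : R :=
  Num.sqrt (\sum_(i < d) x i 0 ^+ 2).

Notation borel_mx R d := (g_sigma_algebraType (@open 'M[R]_d)).

Definition orthogonal_mx (R : realType) (d : nat) : set (borel_mx R d) :=
  [set Q : 'M[R]_d | Q^T *m Q = 1%:M].

(* Haar probability measure on O(d), viewed as a Borel measure on the space of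
   d x d matrices that is carried by O(d); left invariance determines it, since
   O(d) is compact. *)
Definition is_haar (R : realType) (d : nat)
    (mu : probability (borel_mx R d) R) : Prop :=
  mu (@orthogonal_mx R d) = 1%E /\
  forall Q : 'M[R]_d, orthogonal_mx Q ->
  forall A : set (borel_mx R d), measurable A ->
  mu [set (Q *m M : 'M[R]_d) | M in A] = mu A.

Definition orf_feature (R : realType) (p d : nat) (w : 'I_p -> 'cV[R]_d)
    (x : 'cV[R]_d) : 'cV[R]_(p + p) :=
  (Num.sqrt p%:R)^-1 *:
  col_mx (\col_(j < p) sin (((w j)^T *m x) 0 0))
         (\col_(j < p) cos (((w j)^T *m x) 0 0)).

Definition orf_kernel (R : realType) (p d : nat) (w : 'I_p -> 'cV[R]_d)
    (x y : 'cV[R]_d) : R :=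
  ((orf_feature w x)^T *m orf_feature w y) 0 0.

(* Euler's integral; meaningful for a > 0. *)
Definition Gamma (R : realType) (a : R) : R :=
  \int[@lebesgue_measure R]_(t in `]0, +oo[) (t `^ (a - 1) * expR (- t)).

Definition normalized_bessel (R : realType) (nu z : R) : R :=
  limn (series (fun n : nat =>
    (-1) ^+ n * Gamma (nu + 1) / (n`!%:R * Gamma (n%:R + (nu + 1)))
    * (z / 2) ^+ (2 * n))).

(* Main.v *)
Require Import Defs.
From HB Require Import structures.
From mathcomp Require Import all_boot all_order all_algebra.
From mathcomp Require Import all_classical all_reals all_analysis.
From mathcomp Require Import measurable_realfun exponential_distribution ring lra.

Set Implicit Arguments.
Unset Strict Implicit.
Unset Printing Implicit Defensive.

Import Order.TTheory GRing.Theory Num.Theory.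
Import numFieldNormedType.Exports.

Local Open Scope classical_set_scope.
Local Open Scope ring_scope.

(* By invariance and the Householder reflections, the k-th moment of w.u, for a
   column w of O, is |u|^k m_k, where m_k is the k-th moment of a fixed entry of
   w.  Applied to u = e_a + t e_b, this identifies two polynomials in t; the
   coefficients of t^2 give E[w_a^(2n) w_b^2] (2n+1) = m_(2n+2), and summing over
   b with |w| = 1 yields (d+2n) m_(2n+2) = (2n+1) m_(2n).  The functional equation
   of Gamma turns the solution of this recurrence into the Bessel coefficients,
   and dominated convergence integrates the cosine series term by term. *)

(** * Auxiliary facts on polynomials and on partial sums of the cosine series *)

Lemma horner_ext (R : numDomainType) (p q : {poly R}) :
  (forall t, p.[t] = q.[t]) -> p = q.
Proof.
move=> pq; apply/eqP; rewrite -subr_eq0; apply/eqP.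
(* The difference has as many roots as its size: the naturals are distinct points in a
   [numDomainType]. *)
apply: (@roots_geq_poly_eq0 _ _ [seq k%:R | k <- iota 0 (size (p - q))]).
- by apply/allP => t _; rewrite rootE hornerD hornerN pq subrr.
- by rewrite map_inj_uniq ?iota_uniq//; exact: mulrIn (oner_neq0 _).
- by rewrite size_map size_iota.
Qed.

Lemma coef2_1DX2_exp (R : comNzRingType) n : ((1 + 'X^2 : {poly R}) ^+ n)`_2 = n%:R.
Proof.
elim: n => [|n ih]; first by rewrite expr0 coef1.
by rewrite exprSr mulrDr mulr1 coefD ih coefMXn/= subnn -horner_coef0 horner_exp
  !hornerE expr0n addr0 expr1n natr1.
Qed.

Lemma leq_fact_double n : (n`! <= n.*2`!)%N.
Proof. by apply: leq_fact; rewrite -addnn leq_addr. Qed.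

(** Termwise, x^(2k)/(2k)! <= (x^2)^k/k!, so the exponential series at x^2 dominates. The bound is
    uniform in n, as dominated convergence requires. *)
Lemma normr_series_cos_coeff' (R : realType) (x : R) n :
  `|series (cos_coeff' x) n| <= expR (x ^+ 2).
Proof.
rewrite /series/= (le_trans (ler_norm_sum _ _ _))//.
apply: (@le_trans _ _ (series (exp_coeff (x ^+ 2)) n)).
  apply: ler_sum => k _; rewrite /cos_coeff' /exp_coeff /= !normrM -exprnP.
  rewrite normrX normrN1 expr1n mul1r normrX -mul2n exprM.
  rewrite real_normK ?num_real// normfV normr_nat.
  apply: ler_wpM2l; first by rewrite exprn_ge0// sqr_ge0.
  by rewrite lef_pV2 ?posrE ?ltr0n ?fact_gt0// ler_nat mul2n leq_fact_double.
apply: nondecreasing_cvgn_le; last exact: is_cvg_series_exp_coeff.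
apply/nondecreasing_seqP => k; rewrite seriesSr lerDl.
by rewrite exp_coeff_ge0// sqr_ge0.
Qed.

(** * Euler's integral: integrability, positivity and functional equation for a >= 1 *)

Section gamma_function.
Context {R : realType}.
Notation mu := (@lebesgue_measure R).

(** With q = t/(2a), raise q <= 1 + q <= e^q to the power a and multiply by (2a)^a. *)
Lemma powR_le_expR (a t : R) : 0 <= a -> 0 <= t ->
  t `^ a <= (2 * a) `^ a * expR (t / 2).
Proof.
move=> a_ge0 t_ge0; have [->|a_neq0] := eqVneq a 0.
  by rewrite !powRr0 mul1r -expR0 ler_expR divr_ge0.
have a_gt0 : 0 < a by rewrite lt_neqAle eq_sym a_neq0.
have b_gt0 : 0 < 2 * a by rewrite mulr_gt0.
have q_ge0 : 0 <= t / (2 * a) by rewrite divr_ge0// ltW.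
have -> : t / 2 = t / (2 * a) * a by field; lra.
have {1}-> : t = 2 * a * (t / (2 * a)) by field; lra.
rewrite expRM powRM ?(ltW b_gt0)//; apply: ler_wpM2l; first exact: powR_ge0.
apply: ge0_ler_powR; rewrite ?nnegrE ?expR_ge0//.
by apply: le_trans (expR_ge1Dx _); rewrite lerDr.
Qed.

Definition gamma_integrand (a t : R) : R := t `^ a * expR (- t).

Lemma gamma_integrand_le (a t : R) : 0 <= a -> 0 <= t ->
  gamma_integrand a t <= (2 * a) `^ a * expR (- (t / 2)).
Proof.
move=> a_ge0 t_ge0; rewrite /gamma_integrand.
have -> : - (t / 2) = t / 2 - t by field.
by rewrite expRD mulrA ler_wpM2r ?expR_ge0// powR_le_expR.
Qed.

Lemma gamma_integrand_ge0 (a t : R) : 0 <= gamma_integrand a t.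
Proof. by rewrite mulr_ge0 ?powR_ge0 ?expR_ge0. Qed.

Lemma measurable_gamma_integrand (a : R) D :
  measurable_fun D (gamma_integrand a).
Proof.
apply: measurable_funTS; apply: measurable_funM; first exact: measurable_powR.
by apply: measurableT_comp => //; exact: measurable_expR.
Qed.

(** Ties the majorant to the exponential density of rate 1/2, from which its integrability and its
    integral are read off. *)
Lemma half_expRE (t : R) : 0 <= t ->
  expR (- (t / 2)) = 2 * exponential_pdf 2^-1 t.
Proof.
move=> t_ge0; rewrite exponential_pdfE// mulrA mulfV// mul1r.
by congr expR; rewrite mulNr mulrC.
Qed.

Lemma integrable_half_expR :
  mu.-integrable `[0, +oo[ (fun t => (expR (- (t / 2)))%:E).
Proof.
have h : mu.-integrable `[0, +oo[ (EFin \o exponential_pdf (2^-1 : R)).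
  by apply: (integrableS measurableT) => //; exact: integrable_exponential_pdf.
apply: eq_integrable (integrableZl _ 2 h) => //= t.
by rewrite inE/= in_itv/= andbT => t0; rewrite half_expRE// EFinM.
Qed.

Lemma Rintegral_half_expR : \int[mu]_(t in `[0, +oo[) expR (- (t / 2)) = 2.
Proof.
under eq_Rintegral.
  move=> t; rewrite inE/= in_itv/= andbT => t0; rewrite half_expRE//; over.
rewrite RintegralZl//; last first.
  by apply: (integrableS measurableT) => //; exact: integrable_exponential_pdf.
(* The density already vanishes on the negative axis, so cutting it off there changes nothing. *)
rewrite Rintegral_mkcond (_ : _ \_ _ = exponential_pdf 2^-1).
  by rewrite /Rintegral integral_exponential_pdf//= mulr1.
by apply/funext => t; rewrite /exponential_pdf 3?patchE; case: ifP => h; rewrite ?h.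
Qed.

Lemma integrable_gamma_integrand (a : R) : 0 <= a ->
  mu.-integrable `[0, +oo[ (EFin \o gamma_integrand a).
Proof.
move=> a_ge0.
apply: le_integrable (integrableZl _ ((2 * a) `^ a) integrable_half_expR) => //.
  by apply/measurable_EFinP; exact: measurable_gamma_integrand.
move=> t /=; rewrite in_itv/= andbT => t0.
rewrite lee_fin !ger0_norm ?gamma_integrand_ge0 ?gamma_integrand_le//.
by rewrite mulr_ge0 ?powR_ge0 ?expR_ge0.
Qed.

Lemma GammaE (a : R) : 1 <= a ->
  Gamma a = \int[mu]_(t in `[0, +oo[) gamma_integrand (a - 1) t.
Proof.
move=> a_ge1; rewrite /Gamma Rintegral_itv_obnd_cbnd//.
apply: (@integrableS _ _ _ mu `[0, +oo[%classic) => //.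
  by apply: subset_itvr; rewrite bnd_simp.
by apply: integrable_gamma_integrand; rewrite subr_ge0.
Qed.

(** On [1, 2], an interval of length 1, the integrand is at least e^(-2); elsewhere it is
    nonnegative. *)
Lemma Gamma_gt0 (a : R) : 1 <= a -> 0 < Gamma a.
Proof.
move=> a_ge1; rewrite GammaE//.
have a1_ge0 : 0 <= a - 1 by rewrite subr_ge0.
apply: (@lt_le_trans _ _ (\int[mu]_(t in `[1, 2]) gamma_integrand (a - 1) t)).
  have mu12 : mu `[1, 2]%classic = 1%E.
    rewrite lebesgue_measure_itv/= lte_fin ltr1n/= -EFinD; congr EFin; lra.
  apply: (@lt_le_trans _ _ (\int[mu]_(t in `[1, 2]) expR (- 2))).
    by rewrite Rintegral_cst// [X in fine X]mu12 mulr1 expR_gt0.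
  apply: le_Rintegral => //.
  - apply: measurable_bounded_integrable => //; first by rewrite [X in (X < _)%E]mu12 ltry.
    exact: bounded_cst.
  - apply: integrableS (integrable_gamma_integrand a1_ge0) => //.
    by move=> t/=; rewrite !in_itv/= andbT => /andP[+ _]; apply: le_trans.
  - move=> t /=; rewrite in_itv/= => /andP[t1 t2]; rewrite /gamma_integrand.
    rewrite -[leLHS]mul1r ler_pM ?expR_ge0//; last by rewrite ler_expR lerN2.
    apply: (@le_trans _ _ (1 `^ (a - 1))); first by rewrite powR1.
    by apply: ge0_ler_powR; rewrite ?nnegrE// (le_trans ler01).
apply: fine_le.
- apply: integrable_fin_num => //.
  apply: integrableS (integrable_gamma_integrand a1_ge0) => //.
  by move=> t/=; rewrite !in_itv/= andbT => /andP[+ _]; apply: le_trans.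
- by apply: integrable_fin_num => //; exact: integrable_gamma_integrand.
apply: ge0_subset_integral => //.
- by apply/measurable_EFinP; exact: measurable_gamma_integrand.
- by move=> t _; rewrite lee_fin gamma_integrand_ge0.
by move=> t/=; rewrite !in_itv/= andbT => /andP[+ _]; apply: le_trans.
Qed.

Lemma is_derive_gamma_primitive (a K t : R) : 0 < t ->
  is_derive t 1 (fun t => t `^ a * expR (- t) - K * expR (- (t / 2)))
    (a * gamma_integrand (a - 1) t - gamma_integrand a t
     + K / 2 * expR (- (t / 2))).
Proof.
move=> t_gt0; rewrite /gamma_integrand.
have dp : is_derive t 1 (@powR R ^~ a) (a * t `^ (a - 1)).
  exact: is_derive1_powR.
(* One computation serves both exponentials, with c = 1 and c = 1/2. *)
have dN (c : R) : is_derive t 1 (fun s : R => expR (- (s * c)))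
    (- c * expR (- (t * c))).
  have -> : (fun s : R => expR (- (s * c))) = expR \o (fun s => (- c) *: s).
    by apply/funext => s /=; congr expR; rewrite /GRing.scale/=; ring.
  apply: is_derive_eq.
  rewrite /GRing.scale/= mulr1 mulrC; congr (_ * expR _). ring.
have d1 := dN 1; have d2 := dN 2^-1.
have {}d1 : is_derive t 1 (fun s : R => expR (- s)) (- expR (- t)).
  by move: d1; under eq_fun do rewrite mulr1; rewrite mulr1 mulN1r.
rewrite (_ : (fun _ => _) = (@powR R ^~ a) * (fun s : R => expR (- s))
  - K *: (fun s : R => expR (- (s / 2))))//.
apply: is_derive_eq.
rewrite /GRing.scale/=; ring.
Qed.

Lemma continuous_half_expR : continuous (fun t : R => expR (- (t / 2))).
Proof.
move=> t; apply: continuous_comp; last exact: continuous_expR.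
by apply: continuousN; exact: mulrr_continuous.
Qed.

Lemma continuous_gamma_integrand (a t : R) : 0 < t ->
  {for t, continuous (gamma_integrand a)}.
Proof.
move=> t_gt0; have [dt _] := is_derive1_powR a t_gt0.
have /derivable1_diffP/differentiable_continuous ct := dt.
apply: cvgM; first exact: ct.
by apply: continuous_comp; [exact: opp_continuous|exact: continuous_expR].
Qed.

Lemma cvg_half_expR : expR (- (t / 2)) @[t --> +oo] --> (0 : R).
Proof.
rewrite (_ : (fun t => _) = (fun z => expR (- z)) \o (fun z : R => z / 2))//.
apply: (@cvg_comp _ _ _ _ _ _ (pinfty_nbhs R)); last exact: cvgr_expR.
exact: gt0_cvgMly.
Qed.

Lemma cvg_gamma_integrandy (a : R) : 0 <= a ->
  gamma_integrand a t @[t --> +oo] --> (0 : R).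
Proof.
move=> a_ge0.
apply: (@squeeze_cvgr _ _ _ _ (cst 0) (fun t => (2 * a) `^ a * expR (- (t / 2)))).
- near=> t; rewrite gamma_integrand_ge0 gamma_integrand_le//.
- exact: cvg_cst.
- rewrite -[X in _ --> X](mulr0 ((2 * a) `^ a)).
  by apply: cvgM; [exact: cvg_cst|exact: cvg_half_expR].
Unshelve. all: end_near. Qed.

Lemma cvg_gamma_integrand0 (a : R) : 0 <= a ->
  gamma_integrand a t @[t --> 0^'+] --> gamma_integrand a 0.
Proof.
move=> a_ge0; rewrite /gamma_integrand; apply: cvgM; last first.
  apply: cvg_at_right_filter; apply: continuous_comp; first exact: opp_continuous.
  exact: continuous_expR.
(* The case a = 0 is separate because 0 [^ 0 = 1, whereas 0]^ a = 0 for the other exponents. *)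
have [->|a_neq0] := eqVneq a 0.
  by under eq_fun do rewrite powRr0; rewrite powRr0; exact: cvg_cst.
by rewrite powR0//; apply: powR_cvg0; rewrite lt_neqAle eq_sym a_neq0.
Qed.

(* The primitive t^a e^(-t) - K e^(-t/2) has a nonnegative derivative for large
   K, as the improper fundamental theorem of calculus requires. *)
Lemma Gamma_succ (a : R) : 1 <= a -> Gamma (1 + a) = a * Gamma a.
Proof.
move=> a_ge1.
have a1_ge0 : 0 <= a - 1 by rewrite subr_ge0.
have a_ge0 : 0 <= a := le_trans ler01 a_ge1.
(* Chosen so that K / 2 is the constant of [gamma_integrand_le]: the last term of [f] then outweighs
   the negative one. *)
pose K := 2 * (2 * a) `^ a.
pose f t := a * gamma_integrand (a - 1) t - gamma_integrand a t
     + K / 2 * expR (- (t / 2)).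
pose F t := gamma_integrand a t - K * expR (- (t / 2)).
have dF (t : R) : 0 < t -> is_derive t 1 F (f t).
  exact: is_derive_gamma_primitive.
have cF0 : F t @[t --> 0^'+] --> F 0.
  apply: cvgB; first exact: cvg_gamma_integrand0.
  apply: cvgM; first exact: cvg_cst.
  by apply: cvg_at_right_filter; exact: continuous_half_expR.
have cf : {within `[0, +oo[, continuous f}.
  apply/continuous_within_itvcyP; split.
    move=> t; rewrite in_itv/= andbT => t0.
    apply: cvgD; first apply: cvgB.
    - by apply: cvgM; [exact: cvg_cst|exact: continuous_gamma_integrand].
    - exact: continuous_gamma_integrand.
    - by apply: cvgM; [exact: cvg_cst|exact: continuous_half_expR].
  apply: cvgD; first apply: cvgB.
  - by apply: cvgM; [exact: cvg_cst|exact: cvg_gamma_integrand0].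
  - exact: cvg_gamma_integrand0.
  - apply: cvgM; first exact: cvg_cst.
    by apply: cvg_at_right_filter; exact: continuous_half_expR.
have : \int[mu]_(t in `[0, +oo[) f t = 0 - F 0.
  apply: Rintegral_ge0_continuous_FTC2y => //.
  - move=> t t0; rewrite /f; have := gamma_integrand_le a_ge0 t0.
    have -> : K / 2 = (2 * a) `^ a by rewrite /K; field.
    have := mulr_ge0 a_ge0 (gamma_integrand_ge0 (a - 1) t); lra.
  - rewrite -(subr0 0) /F; apply: cvgB; first exact: cvg_gamma_integrandy.
    rewrite -[X in _ --> X](mulr0 K).
    by apply: cvgM; [exact: cvg_cst|exact: cvg_half_expR].
  - by move=> t t0; have [] := dF _ t0.
  - move=> t; rewrite in_itv/= andbT => t0.
    by rewrite derive1E; have [_ ->] := dF _ t0.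
have F0 : F 0 = - K.
  rewrite /F /gamma_integrand mul0r oppr0 expR0 !mulr1 powR0 ?sub0r//.
  by rewrite gt_eqF// (lt_le_trans ltr01).
rewrite F0 sub0r opprK /f.
have i1 : mu.-integrable `[0, +oo[
    (EFin \o (fun t => a * gamma_integrand (a - 1) t)).
  exact: (integrableZl _ a (integrable_gamma_integrand a1_ge0)).
have i2 := integrable_gamma_integrand a_ge0.
have i3 : mu.-integrable `[0, +oo[ (EFin \o (fun t => K / 2 * expR (- (t / 2)))).
  exact: (integrableZl _ (K / 2) integrable_half_expR).
rewrite RintegralD//; last exact: (integrableB _ i1 i2).
rewrite RintegralB// !RintegralZl//; last 2 first.
- exact: integrable_half_expR.
- exact: integrable_gamma_integrand.
(* The integral of [f] is K, and its auxiliary term alone contributes K / 2 times 2; K cancels and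
   the other two terms must sum to zero. *)
rewrite Rintegral_half_expR divfK// -GammaE// => /(canRL (addrK _)).
rewrite subrr => /eqP; rewrite subr_eq0 => /eqP ->.
by rewrite GammaE ?lerDl// (_ : 1 + a - 1 = a)// addrAC subrr add0r.
Qed.

End gamma_function.

(** * Measurability on the space of matrices, and the orthogonal group *)

Section borel_matrices.
Context {R : realType} {d : nat}.
Notation orth := (@orthogonal_mx R d).

Lemma measurable_fun_continuous_mx (f : 'M[R]_d -> R) : continuous f ->
  measurable_fun setT (f : borel_mx R d -> R).
Proof.
move=> /continuousP cf; apply: (measurability _ (RGenOpens.measurableE R)).
move=> _ [_ [a [b ->] <-]]; rewrite setTI.
by apply: sub_sigma_algebra; apply: cf; apply: interval_open.
Qed.

Lemma measurable_entry (i j : 'I_d) :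
  measurable_fun setT (fun M : borel_mx R d => (M : 'M[R]_d) i j).
Proof. by apply: measurable_fun_continuous_mx; exact: coord_continuous. Qed.

Lemma continuous_mulmx (Q : 'M[R]_d) :
  continuous (mulmx Q : 'M[R]_d -> 'M[R]_d).
Proof.
have cQ i j : continuous (fun M : 'M[R]_d => (Q *m M) i j).
  under eq_fun do rewrite mxE.
  apply: continuous_big => [|k _ M]; first exact: add_continuous.
  apply: (@continuousM R 'M[R]_d (fun=> Q i k) (fun N : 'M[R]_d => N k j)).
    exact: cst_continuous.
  exact: coord_continuous.
(* A neighbourhood of a matrix contains a product of neighbourhoods [B i j] of its entries; the
   finitely many conditions on entries hold simultaneously near M. *)
move=> M P [B BQM BP].
have FM : Filter (nbhs M) by exact: nbhs_filter.
have : \forall N \near M, forall i j, B i j ((Q *m N) i j).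
  apply: (@filter_forall _ _ _ _ FM) => i; apply: (@filter_forall _ _ _ _ FM) => j.
  exact: (cQ i j M _ (BQM i j)).
apply: filterS => N BN; exact: BP.
Qed.

Lemma measurable_mulmx (Q : 'M[R]_d) :
  @measurable_fun _ _ (borel_mx R d) (borel_mx R d) setT (mulmx Q).
Proof.
apply: (@measurability _ _ (borel_mx R d) (borel_mx R d) _ _ (@open 'M[R]_d) erefl) => //.
move=> _ [A oA <-]; rewrite setTI; apply: sub_sigma_algebra.
by move: (@continuous_mulmx Q) => /continuousP; apply.
Qed.

(** O(d) is cut out by finitely many measurable equations, one for each entry of M^T M. *)
Lemma measurable_orthogonal_mx : measurable (orth : set (borel_mx R d)).
Proof.
rewrite (_ : orth = \bigcap_(i : 'I_d) \bigcap_(j : 'I_d)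
  ((fun M : borel_mx R d => \sum_k (M : 'M[R]_d) k i * (M : 'M[R]_d) k j)
     @^-1` [set (i == j)%:R])); last first.
  apply/seteqP; split=> [M /= oM i _ j _ /=|M /= oM].
    have /matrixP/(_ i j) := oM; rewrite !mxE => <-.
    by apply: eq_bigr => k _; rewrite !mxE.
  apply/matrixP => i j; rewrite !mxE -(oM i I j I).
  by apply: eq_bigr => k _; rewrite !mxE.
apply: fin_bigcap_measurable => // i _; apply: fin_bigcap_measurable => // j _.
rewrite -[X in measurable X]setTI.
have : measurable_fun setT
  (fun M : borel_mx R d => \sum_k (M : 'M[R]_d) k i * (M : 'M[R]_d) k j).
  apply: measurable_sum => k; apply: measurable_funM; exact: measurable_entry.
by apply.
Qed.

Lemma orthogonal_mxC (Q : 'M[R]_d) : orthogonal_mx Q -> Q *m Q^T = 1%:M.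
Proof. exact: mulmx1C. Qed.

Lemma orthogonal_mx_tr (Q : 'M[R]_d) : orthogonal_mx Q -> orthogonal_mx Q^T.
Proof. by move=> oQ; rewrite /orthogonal_mx/= trmxK; exact: orthogonal_mxC. Qed.

Lemma orthogonal_mxM (Q M : 'M[R]_d) :
  orthogonal_mx Q -> orthogonal_mx M -> orthogonal_mx (Q *m M).
Proof.
rewrite /orthogonal_mx/= => oQ oM.
by rewrite trmx_mul mulmxA -(mulmxA M^T) oQ mulmx1.
Qed.

Lemma orthogonal_mx_col_norm (M : 'M[R]_d) (c : 'I_d) : orthogonal_mx M ->
  \sum_i M i c ^+ 2 = 1.
Proof.
move=> oM; have /matrixP/(_ c c) := oM; rewrite !mxE eqxx mulr1n => <-.
by apply: eq_bigr => i _; rewrite !mxE expr2.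
Qed.

Lemma orthogonal_mx_entry_le1 (M : 'M[R]_d) (i c : 'I_d) : orthogonal_mx M ->
  `|M i c| <= 1.
Proof.
move=> oM; rewrite -(@ler_pXn2r _ 2)// ?nnegrE// expr1n real_normK ?num_real//.
rewrite -(orthogonal_mx_col_norm c oM) (bigD1 i)//= lerDl.
by apply: sumr_ge0 => k _; exact: sqr_ge0.
Qed.

(** For u != v of equal norm, the reflection in the hyperplane orthogonal to e = u - v exchanges
    them. *)
Lemma householder (u v : 'cV[R]_d) : u^T *m u = v^T *m v ->
  exists2 Q : 'M[R]_d, orthogonal_mx Q & Q *m u = v.
Proof.
move=> uv; have [->|u_neq_v] := eqVneq u v.
  by exists 1%:M; rewrite ?mul1mx// /orthogonal_mx/= trmx1 mulmx1.
pose e := u - v; pose s := (e^T *m e) 0 0.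
have eeE : e^T *m e = s%:M by rewrite [LHS]mx11_scalar.
have s_neq0 : s != 0.
  rewrite /s mxE psumr_eq0; last by move=> i _; rewrite mxE -expr2 sqr_ge0.
  apply: contra u_neq_v => /allP h; rewrite -subr_eq0; apply/eqP/colP => i.
  have /(_ _)/implyP := h i; rewrite mem_index_enum mxE -expr2 sqrf_eq0 => /(_ isT isT)/eqP.
  by move=> ->; rewrite mxE.
clearbody s.
(* Since the norms agree, |e|^2 = 2 |u|^2 - 2 v.u = 2 e.u; this is what makes the reflection
   subtract exactly e from u. *)
have eu : e^T *m u = (s / 2)%:M.
  have vu : v^T *m u = u^T *m v.
    by rewrite [LHS]mx11_scalar [RHS]mx11_scalar -[in RHS](trmxK v) -trmx_mul [in RHS]mxE.
  have : 2 *: (e^T *m u) = s%:M.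
    rewrite -eeE /e linearB/= !mulmxBl !mulmxBr vu uv.
    by rewrite scalerBr !scaler_nat; rewrite !mulr2n opprB addrACA -opprD.
  move=> h; rewrite -[LHS](scalerK (a := 2))// h -scalemx1 scalerA mulrC.
  by rewrite scalemx1.
pose H : 'M[R]_d := 1%:M - (2 / s) *: (e *m e^T).
have Hsym : H^T = H.
  by rewrite /H linearB linearZ/= trmx1 trmx_mul trmxK.
exists H; last first.
  rewrite /H mulmxBl mul1mx -scalemxAl -mulmxA eu mul_mx_scalar scalerA.
  have -> : 2 / s * (s / 2) = 1 by field.
  by rewrite scale1r /e opprB addrC subrK.
rewrite /orthogonal_mx/= Hsym.
rewrite /H mulmxBl mul1mx mulmxBr mulmx1 -!scalemxAl -!scalemxAr.
rewrite mulmxA -(mulmxA e) eeE mul_mx_scalar -scalemxAl !scalerA.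

have -> : 2 / s * (2 / s * s) = 2 / s + 2 / s by field.
by rewrite scalerDl opprB addrK subrK.
Qed.

End borel_matrices.

(** * Expectation over O(d): linearity and invariance *)

Section haar_expectation.
Context {R : realType} {d : nat}.
Notation orth := (@orthogonal_mx R d).

(* The integrands are unbounded polynomials of the entries on the space of all
   matrices, hence the restriction to O(d), which carries the measure. *)
Definition bounded_on_orth (f : borel_mx R d -> R) :=
  measurable_fun setT f /\ exists C, forall M, orth M -> `|f M| <= C.

Lemma bounded_on_orth_entry (i j : 'I_d) :
  bounded_on_orth (fun M => (M : 'M[R]_d) i j).
Proof.
split; first exact: measurable_entry.
by exists 1 => M oM; exact: orthogonal_mx_entry_le1.
Qed.

Lemma bounded_on_orth_cst (c : R) : bounded_on_orth (fun=> c).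
Proof. by split; [exact: measurable_cst|exists `|c|]. Qed.

Lemma bounded_on_orthD f g : bounded_on_orth f -> bounded_on_orth g ->
  bounded_on_orth (fun M => f M + g M).
Proof.
move=> [mf [C fC]] [mg [D gD]]; split; first exact: measurable_funD.
by exists (C + D) => M oM; rewrite (le_trans (ler_normD _ _))// lerD ?fC ?gD.
Qed.

Lemma bounded_on_orthM f g : bounded_on_orth f -> bounded_on_orth g ->
  bounded_on_orth (fun M => f M * g M).
Proof.
move=> [mf [C fC]] [mg [D gD]]; split; first exact: measurable_funM.
by exists (C * D) => M oM; rewrite normrM ler_pM ?fC ?gD.
Qed.

Lemma bounded_on_orthX f n : bounded_on_orth f ->
  bounded_on_orth (fun M => f M ^+ n).
Proof.
move=> bf; elim: n => [|n ih].
  rewrite (_ : (fun M => _) = fun=> 1); first exact: bounded_on_orth_cst.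
  by apply/funext => M; rewrite expr0.
under eq_fun do rewrite exprS; exact: bounded_on_orthM.
Qed.

Lemma bounded_on_orth_sum (I : Type) (r : seq I) (f : I -> borel_mx R d -> R) :
  (forall i, bounded_on_orth (f i)) ->
  bounded_on_orth (fun M => \sum_(i <- r) f i M).
Proof.
move=> bf; elim: r => [|i r ih].
  under eq_fun do rewrite big_nil; exact: bounded_on_orth_cst.
under eq_fun do rewrite big_cons; exact: bounded_on_orthD.
Qed.

Context (mu : probability (borel_mx R d) R) (hmu : is_haar mu).

Definition Eorth (f : borel_mx R d -> R) : R := \int[mu]_(M in orth) f M.

Lemma integrable_bounded_on_orth f : bounded_on_orth f ->
  mu.-integrable orth (EFin \o f).
Proof.
move=> [mf [C fC]]; apply: measurable_bounded_integrable.
- exact: measurable_orthogonal_mx.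
- by have [h _] := hmu; rewrite [X in (X < _)%E]h ltry.
- exact: measurable_funTS.
- exists C; split; first exact: num_real.
  by move=> x Cx M oM /=; rewrite (le_trans (fC _ oM))// ltW.
Qed.

Lemma EorthD f g : bounded_on_orth f -> bounded_on_orth g ->
  Eorth (fun M => f M + g M) = Eorth f + Eorth g.
Proof.
move=> bf bg; apply: RintegralD.
- exact: measurable_orthogonal_mx.
- exact: integrable_bounded_on_orth.
- exact: integrable_bounded_on_orth.
Qed.

Lemma EorthZ c f : bounded_on_orth f -> Eorth (fun M => c * f M) = c * Eorth f.
Proof.
move=> bf; apply: RintegralZl; first exact: measurable_orthogonal_mx.
exact: integrable_bounded_on_orth.
Qed.

Lemma Eorth_cst c : Eorth (fun=> c) = c.
Proof.
rewrite /Eorth Rintegral_cst; last exact: measurable_orthogonal_mx.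
by have [h _] := hmu; rewrite [X in fine X]h mulr1.
Qed.

Lemma Eorth_sum (I : Type) (r : seq I) (f : I -> borel_mx R d -> R) :
  (forall i, bounded_on_orth (f i)) ->
  Eorth (fun M => \sum_(i <- r) f i M) = \sum_(i <- r) Eorth (f i).
Proof.
move=> bf; elim: r => [|i r ih].
  by under [X in Eorth X]eq_fun do rewrite big_nil; rewrite Eorth_cst big_nil.
under [X in Eorth X]eq_fun do rewrite big_cons.
by rewrite EorthD// ?ih ?big_cons//; exact: bounded_on_orth_sum.
Qed.

Lemma eq_Eorth f g : (forall M, orth M -> f M = g M) -> Eorth f = Eorth g.
Proof. by move=> fg; apply: eq_Rintegral => M; rewrite inE => /fg. Qed.

(** Change of variables: left multiplication by Q pushes [mu] forward to itself, and O(d) is its own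
    preimage. *)
Lemma Eorth_mulmx (Q : 'M[R]_d) f : orth Q -> bounded_on_orth f ->
  Eorth (fun M => f (Q *m (M : 'M[R]_d))) = Eorth f.
Proof.
move=> oQ bf; have mQ := measurable_mulmx Q.
have oQ' := orthogonal_mxC oQ.
have imQ : (mulmx Q : borel_mx R d -> borel_mx R d) @^-1` orth = orth.
  apply/seteqP; split=> [M /= oM|M oM]; last exact: orthogonal_mxM.
  rewrite -[M]mul1mx -oQ -mulmxA; apply: orthogonal_mxM => //.
  exact: orthogonal_mx_tr.
rewrite /Eorth /Rintegral; congr fine.
transitivity (\int[pushforward mu (mulmx Q : borel_mx R d -> borel_mx R d)]_(M in orth)
    (f M)%:E)%E; last first.
  apply: eq_measure_integral => A mA _; rewrite /pushforward.
  (* [is_haar] speaks of direct images, so it is applied to Q^T: the preimage of A under Q is the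
     image of A under Q^T. *)
  have h := hmu.2 _ (orthogonal_mx_tr oQ) _ mA; rewrite -[RHS]h.
  congr (mu _); apply/seteqP; split=> [M /= AQM|M /= [N AN <-]].
    by exists (Q *m M) => //; rewrite mulmxA oQ mul1mx.
  by rewrite mulmxA oQ' mul1mx.
rewrite integral_pushforward//.
- by rewrite imQ.
- by apply/measurable_EFinP; exact: bf.1.
- rewrite imQ.
  have : mu.-integrable orth (EFin \o (fun M : borel_mx R d => f (Q *m (M : 'M[R]_d)))).
    apply: integrable_bounded_on_orth; split.
      exact: (measurableT_comp bf.1 mQ).
    case: bf.2 => C fC; exists C => M oM; apply: fC; exact: orthogonal_mxM.
  by [].
- exact: measurable_orthogonal_mx.
Qed.

(** * Moments of the inner products of a column with fixed vectors *)

Definition colprod (c : 'I_d) (u : 'cV[R]_d) (M : borel_mx R d) : R :=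
  ((col c (M : 'M[R]_d))^T *m u) 0 0.

Lemma colprodE c u (M : 'M[R]_d) : colprod c u M = \sum_i u i 0 * M i c.
Proof.
by rewrite /colprod mxE; apply: eq_bigr => i _; rewrite !mxE mulrC.
Qed.

Lemma colprod_mulmx c u (Q M : 'M[R]_d) :
  colprod c u (Q *m M) = colprod c (Q^T *m u) M.
Proof. by rewrite /colprod !colE -(mulmxA Q) trmx_mul !mulmxA. Qed.

Lemma bounded_on_orth_colprod c u : bounded_on_orth (colprod c u).
Proof.
rewrite (_ : colprod c u = fun M => \sum_i u i 0 * (M : 'M[R]_d) i c).
  apply: bounded_on_orth_sum => i.
  apply: bounded_on_orthM; first exact: bounded_on_orth_cst.
  exact: bounded_on_orth_entry.
by apply/funext => M; exact: colprodE.
Qed.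

Lemma Eorth_colprodX_eq c (u v : 'cV[R]_d) k : u^T *m u = v^T *m v ->
  Eorth (fun M => colprod c u M ^+ k) = Eorth (fun M => colprod c v M ^+ k).
Proof.
move=> /householder[Q oQ <-].
rewrite -[LHS](Eorth_mulmx (orthogonal_mx_tr oQ)).
  by apply: eq_Eorth => M _; rewrite colprod_mulmx trmxK.
by apply: bounded_on_orthX; exact: bounded_on_orth_colprod.
Qed.

Definition moment (c i0 : 'I_d) k : R :=
  Eorth (fun M => (M : 'M[R]_d) i0 c ^+ k).

Lemma Eorth_colprodX c i0 (u : 'cV[R]_d) k :
  Eorth (fun M => colprod c u M ^+ k) = enorm u ^+ k * moment c i0 k.
Proof.
(* A vector as long as u along one coordinate axis: its product with the column is a multiple of a
   single entry. *)
pose v : 'cV[R]_d := enorm u *: delta_mx i0 0.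
rewrite (@Eorth_colprodX_eq c u v).
  rewrite /moment -EorthZ; last by apply: bounded_on_orthX; exact: bounded_on_orth_entry.
  apply: eq_Eorth => M _; rewrite colprodE -exprMn (bigD1 i0)//= big1 => [|i ii0].
    by rewrite addr0 !mxE !eqxx mulr1.
  by rewrite !mxE (negbTE ii0) !(mulr0, mul0r).
rewrite [LHS]mx11_scalar [RHS]mx11_scalar; congr (_%:M).
rewrite !mxE [in RHS](bigD1 i0)//= [X in _ + X]big1 => [|i ii0]; last first.
  by rewrite !mxE (negbTE ii0) !(mulr0, mul0r).
rewrite !mxE !eqxx !mulr1 addr0 -expr2 sqr_sqrtr.
  by apply: eq_bigr => i _; rewrite mxE expr2.
by apply: sumr_ge0 => i _; exact: sqr_ge0.
Qed.

(** With N = 2n + 2, the binomial expansion of E[(w_i0 + t w_i)^N] equals (1 + t^2)^(n+1) m_N for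
    every t; the coefficients of t^2 are compared. *)
Lemma mixed_moment c i0 i n : i != i0 ->
  Eorth (fun M => (M : 'M[R]_d) i0 c ^+ n.*2 * (M : 'M[R]_d) i c ^+ 2)
    * n.*2.+1%:R = moment c i0 n.*2.+2.
Proof.
move=> ii0; set N := n.*2.+2.
pose f k (M : borel_mx R d) := (M : 'M[R]_d) i0 c ^+ (N - k) * (M : 'M[R]_d) i c ^+ k.
have bf k : bounded_on_orth (f k).
  by apply: bounded_on_orthM; apply: bounded_on_orthX; exact: bounded_on_orth_entry.
have : \poly_(k < N.+1) (Eorth (f k) *+ 'C(N, k)) =
    moment c i0 N *: (1 + 'X^2) ^+ n.+1.
  apply: horner_ext => t; rewrite horner_poly hornerZ horner_exp !hornerE.
  pose u : 'cV[R]_d := delta_mx i0 0 + t *: delta_mx i 0.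
  have uE : enorm u ^+ N = (1 + t ^+ 2) ^+ n.+1.
    rewrite /N -doubleS -muln2 mulnC exprM sqr_sqrtr; last first.
      by apply: sumr_ge0 => k _; exact: sqr_ge0.
    congr (_ ^+ _); rewrite (bigD1 i0)//= (bigD1 i)//= big1 => [|k /andP[ki0 ki]].
      by rewrite !mxE !eqxx (negbTE ii0) eq_sym (negbTE ii0) !(mulr0, mulr1, addr0, add0r) expr1n.
    by rewrite !mxE (negbTE ki0) (negbTE ki) mulr0 addr0 expr0n.
  have := Eorth_colprodX c i0 u N; rewrite uE mulrC => <-.
  rewrite -[RHS](eq_Eorth (f := fun M => \sum_(k < N.+1) (t ^+ k *+ 'C(N, k)) * f k M)).
    rewrite Eorth_sum => [|k]; last first.
      by apply: bounded_on_orthM => //; exact: bounded_on_orth_cst.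
    by apply: eq_bigr => k _; rewrite EorthZ// mulrnAl mulrC mulrnAl.
  move=> M _; rewrite colprodE (bigD1 i0)//= (bigD1 i)//= [X in (_ + (_ + X)) ^+ _]big1 => [|k /andP[ki0 ki]].
    rewrite !mxE !eqxx (negbTE ii0) eq_sym (negbTE ii0) !(mulr0, mulr1, addr0, add0r, mul1r).
    rewrite exprDn; apply: eq_bigr => k _.
    by rewrite /f exprMn mulrCA mulrnAl.
  by rewrite !mxE (negbTE ki0) (negbTE ki) mulr0 addr0 mul0r.
move/(congr1 (fun p : {poly R} => p`_2)).
rewrite coef_poly coefZ coef2_1DX2_exp/= /f /N subSS subSS subn0.
(* The coefficients are C(2n+2, 2) = (n+1)(2n+1) on the left and n+1 on the right; the common factor
   is cancelled. *)
move=> h; apply: (@mulIf _ n.+1%:R); first by rewrite pnatr_eq0.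
rewrite -h -mulrA -natrM -[RHS]mulr_natr; congr (_ * _%:R).
by rewrite bin2 -[n.*2.+2]doubleS -doubleMl doubleK mulnC.
Qed.

(** Insert the squared norm 1 of the column into m_(2n) and multiply by 2n+1: the index i0 gives
    2n+1 copies of m_(2n+2), each of the d-1 others gives one. *)
Lemma moment_rec c i0 n :
  (d + n.*2)%:R * moment c i0 n.*2.+2 = n.*2.+1%:R * moment c i0 n.*2.
Proof.
have -> : moment c i0 n.*2 = \sum_i
    Eorth (fun M => (M : 'M[R]_d) i0 c ^+ n.*2 * (M : 'M[R]_d) i c ^+ 2).
  rewrite -Eorth_sum => [|i]; last first.
    by apply: bounded_on_orthM; apply: bounded_on_orthX; exact: bounded_on_orth_entry.
  apply: eq_Eorth => M oM.
  by rewrite -mulr_sumr orthogonal_mx_col_norm// mulr1.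
rewrite (bigD1 i0)//= mulrDr mulr_sumr.
under eq_Eorth do rewrite -exprD addn2.
rewrite -/(moment c i0 n.*2.+2).
under eq_bigr => i ii0 do rewrite mulrC mixed_moment//.
rewrite sumr_const cardC1 card_ord -(mulr_natl (moment c i0 _)) -mulrDl; congr (_ * _).
(* The index [i0] excludes d = 0, so the truncated d - 1 is a true predecessor. *)
rewrite -natrD; congr (_%:R); case: (d) i0 => [[]//|d' _] /=.
by rewrite addSnnS addnC.
Qed.

(** Both sides are 1 at n = 0 and have the same ratio of consecutive terms, since (2n+1)(2n+2) /
    (4(n+1)(n+d/2)) = (2n+1)/(d+2n). That d >= 2 keeps the Gamma arguments at least 1. *)
Lemma moment_closed_form c i0 n : (2 <= d)%N ->
  moment c i0 n.*2 = (n.*2)`!%:R * Gamma (d%:R / 2)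
    / (n`!%:R * Gamma (n%:R + d%:R / 2) * 4 ^+ n).
Proof.
move=> d_ge2; have d2_ge1 : 1 <= d%:R / 2 :> R.
  by rewrite ler_pdivlMr// mul1r ler_nat.
have G_gt0 k : 0 < Gamma (k%:R + d%:R / 2 : R).
  by apply: Gamma_gt0; rewrite (le_trans d2_ge1)// lerDr.
elim: n => [|n ih].
  rewrite /moment; under eq_Eorth do rewrite expr0.
  by rewrite Eorth_cst fact0 add0r !mul1r expr0 mulr1 divff// gt_eqF// Gamma_gt0.
have dn0 : (d + n.*2)%:R != 0 :> R by rewrite pnatr_eq0 -lt0n addn_gt0 (ltn_trans _ d_ge2).
apply: (mulfI dn0); rewrite doubleS moment_rec ih.
rewrite -(nat1r n) -addrA Gamma_succ; last by rewrite (le_trans d2_ge1)// lerDr.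
rewrite !factS !natrM exprS.
(* Gamma values, factorials and powers become variables, which leaves a rational identity for
   [field]. *)
have := G_gt0 n; move: (Gamma (n%:R + _)) => g g_gt0.
move: (Gamma _) => g0.
have f0 : n`!%:R != 0 :> R by rewrite pnatr_eq0 -lt0n fact_gt0.
have e0 : 4 ^+ n != 0 :> R by rewrite expf_neq0// pnatr_eq0.
move: f0 e0; move: (n`!%:R : R) (4 ^+ n : R) ((n.*2)`!%:R : R) => f e h f0 e0.
have n1 : (n%:R : R) + 1 != 0 by rewrite natr1 pnatr_eq0.
move: dn0; rewrite natrD -muln2 natrM -[(n * 2).+2%:R]natr1 -[(n * 2).+1%:R]natr1 natrM.
move=> dn0; rewrite -[n.+1%:R]natr1.
have g_neq0 : g != 0 by rewrite gt_eqF.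
by field; rewrite g_neq0 f0 e0 n1 (addrC _ d%:R) dn0.
Qed.

(** * Term-by-term integration of the cosine series *)

Lemma Eorth_cos_coeff' c u n : (2 <= d)%N ->
  Eorth (fun M => cos_coeff' (colprod c u M) n) =
  (-1) ^+ n * Gamma (d%:R / 2 - 1 + 1) / (n`!%:R * Gamma (n%:R + (d%:R / 2 - 1 + 1)))
    * (enorm u / 2) ^+ (2 * n).
Proof.
move=> d_ge2; rewrite subrK.
rewrite (_ : (fun M => _) = fun M => ((-1) ^+ n / n.*2`!%:R) * colprod c u M ^+ n.*2).
  rewrite EorthZ; last by apply: bounded_on_orthX; exact: bounded_on_orth_colprod.
  (* The (2n)! of the moment cancels that of the cosine coefficient, and its 4^n turns |u|^(2n) into
     (|u|/2)^(2n). *)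
  rewrite (Eorth_colprodX _ c) moment_closed_form// mul2n.
  have four : 2 ^+ n.*2 = 4 ^+ n :> R by rewrite -mul2n exprM -natrX.
  rewrite expr_div_n four.
  have f0 : n.*2`!%:R != 0 :> R by rewrite pnatr_eq0 -lt0n fact_gt0.
  rewrite !invfM; move: (n`!%:R^-1) (Gamma (n%:R + _))^-1 (4 ^+ n)^-1 => A B E.
  move: ((-1) ^+ n) (enorm u ^+ n.*2) => S Z.
  by field.
by apply/funext => M; rewrite /cos_coeff' -exprnP mulrAC.
Qed.

Lemma bounded_on_orth_cos c u : bounded_on_orth (fun M => cos (colprod c u M)).
Proof.
split.
  apply: measurableT_comp; last exact: (bounded_on_orth_colprod c u).1.
  by apply: continuous_measurable_fun; exact: continuous_cos.
by exists 1 => M _; rewrite ler_norml cos_geN1 cos_le1.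
Qed.

Lemma Eorth_cos c u : (2 <= d)%N ->
  Eorth (fun M => cos (colprod c u M)) = normalized_bessel (d%:R / 2 - 1) (enorm u).
Proof.
move=> d_ge2; apply/esym; apply: cvg_lim => //.
have [_ [C XC]] := bounded_on_orth_colprod c u.
have bc n : bounded_on_orth (fun M => cos_coeff' (colprod c u M) n).
  apply: bounded_on_orthM; last exact: bounded_on_orth_cst.
  apply: bounded_on_orthM; first exact: bounded_on_orth_cst.
  by apply: bounded_on_orthX; exact: bounded_on_orth_colprod.
have bs n : bounded_on_orth (fun M => series (cos_coeff' (colprod c u M)) n).
  exact: bounded_on_orth_sum.
have mO := @measurable_orthogonal_mx R d.
(* The dominating function is a constant: C bounds [colprod] on O(d), and partial sums at x are at
   most e^(x^2). *)
have [//|||||_ _] := @dominated_convergence _ _ _ mu _ mO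
  (fun n M => (series (cos_coeff' (colprod c u M)) n)%:E)
  (fun M => (cos (colprod c u M))%:E) (cst (expR (C ^+ 2))%:E).
- by move=> n; apply/measurable_EFinP/measurable_funTS; exact: (bs n).1.
- by apply/measurable_EFinP/measurable_funTS; exact: (bounded_on_orth_cos c u).1.
- by apply: aeW => M _; apply: cvg_EFin; [exact: nearW|exact: cvg_cos_coeff'].
- exact: (integrable_bounded_on_orth (bounded_on_orth_cst _)).
- apply: aeW => M n oM; rewrite lee_fin.
  rewrite (le_trans (normr_series_cos_coeff' _ _))// ler_expR.
  by rewrite -[leLHS]real_normK ?num_real// lerXn2r ?nnegrE ?XC// (le_trans _ (XC _ oM)).
move=> cvgE.
(* The partial sums of the Bessel series are the expectations of those of the cosine series. *)
rewrite (_ : series _ = fine \o (fun n => (\int[mu]_(M in orth)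
    (series (cos_coeff' (colprod c u M)) n)%:E)%E)).
  apply: fine_cvg; rewrite fineK//.
  exact/integrable_fin_num/integrable_bounded_on_orth/bounded_on_orth_cos.
apply/funext => n; rewrite /series/= -[RHS]/(Eorth _) Eorth_sum//.
by apply: eq_bigr => k _; rewrite Eorth_cos_coeff'.
Qed.

End haar_expectation.

(** * From the feature map and the random matrix to integrals over O(d) *)

Lemma orf_kernelE (R : realType) (p d : nat) (w : 'I_p -> 'cV[R]_d)
    (x y : 'cV[R]_d) :
  orf_kernel w x y = p%:R^-1 * \sum_j cos (((w j)^T *m (x - y)) 0 0).
Proof.
rewrite /orf_kernel /orf_feature [(_ *: _)^T]linearZ/= -scalemxAl -scalemxAr scalerA mxE.
congr (_ * _); first by rewrite -invfM -expr2 sqr_sqrtr.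
(* The sine and cosine blocks pair up into the subtraction formula for the cosine. *)
rewrite tr_col_mx mul_row_col !mxE -big_split/=; apply: eq_bigr => j _.
have -> : ((w j)^T *m (x - y)) 0 0 = ((w j)^T *m x) 0 0 - ((w j)^T *m y) 0 0.
  by rewrite mulmxBr !mxE.
by rewrite cosB addrC !mxE.
Qed.

(** The expectation is an integral against the law of [O], and the complement of O(d) is null for
    that law. *)
Lemma expectation_orth (R : realType) disp (Omega : measurableType disp)
    (P : probability Omega R) (d : nat) (O : {RV P >-> borel_mx R d})
    (hO : is_haar (distribution P O)) (f : borel_mx R d -> R) :
  measurable_fun setT f -> (exists C, forall M, `|f M| <= C) ->
  'E_P[f \o O]%E = (Eorth (distribution P O) f)%:E.
Proof.
move=> mf [C fC]; have mO := @measurable_orthogonal_mx R d.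
have bf : bounded_on_orth f by split=> //; exists C.
have ifO : P.-integrable setT (EFin \o (f \o O)).
  apply: measurable_bounded_integrable => //.
  - by rewrite [X in (X < _)%E]probability_setT ltry.
  - by apply: measurableT_comp.
  - exists C; split; first exact: num_real.
    by move=> z Cz w _ /=; rewrite (le_trans (fC _))// ltW.
have ifX : (distribution P O).-integrable setT (EFin \o f).
  apply: measurable_bounded_integrable => //.
  - by rewrite [X in (X < _)%E]probability_setT ltry.
  - exists C; split; first exact: num_real.
    by move=> z Cz w _ /=; rewrite (le_trans (fC _))// ltW.
rewrite unlock -[LHS](@integral_distribution _ _ _ _ _ P O (EFin \o f))//; last first.
  exact/measurable_EFinP.
rewrite (@negligible_integral _ _ _ _ setT (~` (@orthogonal_mx R d))) //; last first.
- rewrite [LHS]probability_setC//.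
  by have [h _] := hO; rewrite [X in (_ - X)%E]h subee.
- exact: measurableC.
rewrite setTD setCK /Eorth /Rintegral fineK//.
exact/integrable_fin_num/(integrable_bounded_on_orth hO).
Qed.

Theorem theorem2 (R : realType) (disp : measure_display)
    (Omega : measurableType disp) (P : probability Omega R)
    (p d : nat) (hp : (2 <= p)%N) (hpd : (p <= d)%N)
    (O : {RV P >-> borel_mx R d}) (hO : is_haar (distribution P O))
    (s : 'I_p -> 'I_d) (hs : injective s) (x y : 'cV[R]_d) :
  'E_P[(fun omega => orf_kernel (fun j => col (s j) (O omega)) x y)]%E =
  (normalized_bessel (d%:R / 2 - 1) (enorm (x - y)))%:E.
Proof.
have d_ge2 := leq_trans hp hpd.
pose f (M : borel_mx R d) : R :=
  p%:R^-1 * \sum_j cos (colprod (s j) (x - y) M).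
rewrite (_ : (fun omega => _) = f \o O); last first.
  by apply/funext => w; rewrite /= orf_kernelE.
have bcos j := bounded_on_orth_cos (s j) (x - y).
rewrite expectation_orth//; last 2 first.
- apply: measurable_funM; first exact: measurable_cst.
  by apply: measurable_sum => j; exact: (bcos j).1.
- exists (p%:R^-1 * \sum_(j < p) 1) => M; rewrite normrM ger0_norm ?invr_ge0//.
  rewrite ler_wpM2l ?invr_ge0// (le_trans (ler_norm_sum _ _ _))//.
  by apply: ler_sum => j _; rewrite ler_norml cos_geN1 cos_le1.
rewrite EorthZ//; last exact: bounded_on_orth_sum.
rewrite Eorth_sum//; congr EFin.
(* Every selected column contributes the same value, so the average of the p terms is that value. *)
under eq_bigr do rewrite Eorth_cos//.
rewrite sumr_const card_ord -[X in _ * X]mulr_natl mulrA mulVf ?mul1r//.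
by rewrite pnatr_eq0 -lt0n (leq_trans _ hp).
Qed.
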